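(* Let $n\ge 1$, let $w$ be a biword in lexicographic order in the alphabet $[n]$, and let $\Phi(w)=(F,G)$. Then every biletter $\binom{i}{j}$ of $w$ satisfies $i+j\le n+1$ if and only if $key(sh(G))\le key(\omega\, sh(F))$, where $\omega$ is the longest permutation of $\mathfrak{S}_n$. Moreover, if the first row of $w$ is a word in the alphabet $[k]$, with $1\le k\le n$, and the second row is a word in the alphabet $[m]$, with $1\le m\le n$, then the shape of $G$ has its last $n-k$ entries equal to zero, and the shape of $F$ has its last $n-m$ entries equal to zero.
   Context: $\mathbb{N}$ includes $0$ and $[n]=\{1,\dots,n\}$. A weak composition is a vector $\gamma=(\gamma_1,\dots,\gamma_n)\in\mathbb{N}^n$; $\gamma^+$ is its weakly decreasing rearrangement. $\mathfrak{S}_n$ acts by permuting positions; in particular, for the longest permutation $\omega$, $\omega\gamma=(\gamma_n,\dots,\gamma_1)$. Key tableau. Semi-standard Young tableaux (SSYTs) are drawn in French convention: rows weakly increase left to right, columns strictly increase from bottom to top. For $\gamma\in\mathbb{N}^n$, $key(\gamma)$ is the SSYT of shape $\gamma^+$ whose $c$-th column has entry set $\{j\in[n]:\gamma_j\ge c\}$. For two tableaux of the same shape, $T\le T'$ means entrywise comparison. (The shapes of $F$ and $G$ below are always rearrangements of each other, so the keys in question have the same shape.) Biword. A biword in lexicographic order in the alphabet $[n]$ is a two-line array $w=\begin{pmatrix} i_1&i_2&\cdots&i_l\\ j_1&j_2&\cdots&j_l\end{pmatrix}$, $l\ge 0$, with $i_r,j_r\in[n]$ such that for each $r<l$ either $i_r<i_{r+1}$,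 or $i_r=i_{r+1}$ and $j_r\le j_{r+1}$. The columns $\binom{i_r}{j_r}$ are its biletters. Augmented fillings. An augmented filling $F$ of shape $sh(F)=\gamma\in\mathbb{N}^n$ consists of $n$ columns, column $c$ having $\gamma_c$ cells (its height) in rows $1,\dots,\gamma_c$ (bottom to top), each containing an element of $[n]$, together with an extra row $0$ (the basement) whose cell in column $c$ contains $c$. Columns are weakly decreasing from bottom to top, basement included. The empty filling has shape $(0,\dots,0)$. Reading order of the cells (basement included): row by row from the highest row down to the basement, left to right within each row. (The fillings produced below are the ''semi-skyline augmented fillings'' (SSAFs).) Insertion $k\to F$ (for $k\in[n]$). Write $F(j)$ for the entry in the $j$-th cell in reading order (basement cells included), and $\hat{j}$ for the position immediately above cell $j$; if that position is empty set $F(\hat{j}):=0$. 1. Set $i:=1$, $x_1:=k$, $j:=1$. 2. If $F(j)<x_i$ or $F(\hat{j})\ge x_i$, increase $j$ by $1$ and repeat this step. Otherwise set $x_{i+1}:=F(\hat{j})$ and then set $F(\hat{j}):=x_i$. 3. If $x_{i+1}\ne 0$, increase $i$ by $1$, increase $j$ by $1$, and repeat step 2. Otherwise terminate (a new cell has been created on top of a column; the insertion terminates at this column). The map $\Phi$ (Mason's analogue of RSK). Start with $F=G=$ the empty filling. For $r=l,l-1,\dots,1$ do: replace $F$ by $(j_r\to F)$ and let $h_r$ be the height, in the new $F$, of the column at which this insertion terminates; then place $i_r$ on top of the leftmost column of $G$ of height $h_r-1$ such that doing so preserves the property that columns (including basement) are weakly decreasing from bottom to top. The final pair is $\Phi(w)=(F,G)$.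 *)

(* Defs.v *)
From mathcomp Require Import all_boot all_fingroup.

Set Implicit Arguments.
Unset Strict Implicit.
Unset Printing Implicit Defensive.

(* The alphabet [n] is {1, ..., n}, whereas positions of weak compositions    *)
(* and columns of fillings are indexed by c : 'I_n: c stands for the          *)
(* (c + 1)-st position, and the letter attached to it is c.+1.                *)

Definition letter (n : nat) : pred nat := fun x => 0 < x <= n.

Definition lex_le (b b' : nat * nat) : bool :=
  (b.1 < b'.1) || (b.1 == b'.1) && (b.2 <= b'.2).

(* The biletter with top entry i and bottom entry j is the pair (i, j).       *)
Definition biword (n : nat) (w : seq (nat * nat)) : bool :=
  all (fun b => letter n b.1 && letter n b.2) w && sorted lex_le w.

Section Compositions.

Variable n : nat.

Definition composition : Type := {ffun 'I_n -> nat}.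

Definition permute (s : 'S_n) (g : composition) : composition :=
  [ffun c => g ((s^-1)%g c)].

Definition longest : 'S_n := perm (@rev_ord_inj n).

Definition decreasing_rearr (g : composition) : seq nat := sort geq (codom g).

(* A tableau is encoded by the sequence of its columns, from left to right,   *)
(* each of them read from bottom to top.                                      *)
Definition tableau : Type := seq (seq nat).

Definition row_length (T : tableau) (r : nat) : nat :=
  count (fun C => r < size C) T.

Definition semistandard (T : tableau) : Prop :=
  (forall C, C \in T -> sorted ltn C) /\
  (forall c r, r < size (nth [::] T c.+1) ->
     nth 0 (nth [::] T c) r <= nth 0 (nth [::] T c.+1) r).

Definition key_column (g : composition) (c : nat) : seq nat :=
  [seq (val j).+1 | j <- enum 'I_n & c <= g j].

Definition key (g : composition) : tableau :=
  [seq key_column g c | c <- iota 1 (\max_(j < n) g j)].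

Lemma count_codom_key_column (g : composition) c :
  size (key_column g c) = count (leq c) (decreasing_rearr g).
Proof.
rewrite /key_column size_map size_filter /decreasing_rearr.
have /seq.permP-> := permEl (perm_sort geq (codom g)).
by rewrite codomE [RHS]count_map.
Qed.

Lemma lt_count_sorted (s : seq nat) c r : sorted geq s -> 0 < c ->
  (r < count (leq c) s) = (c <= nth 0 s r).
Proof.
move=> ss c0; elim: s r ss => [|x s IH] r.
  by rewrite nth_nil [RHS]leqNgt c0.
rewrite /= path_sortedE; last by move=> a b d /= ba da; exact: leq_trans da ba.
case/andP=> /allP xs /IH{}IH; case: (leqP c x) => cx.
  by case: r => [|r] /=; rewrite ?cx // add1n ltnS IH.
have cn i : c <= nth 0 s i -> False.
  case: (ltnP i (size s)) => [/(mem_nth 0)/xs /= h|h]; last first.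
    by rewrite nth_default // leqNgt c0.
  by move/leq_trans/(_ h); rewrite leqNgt cx.
have s0 : count (leq c) s = 0.
  by apply/eqP; rewrite -leqn0 leqNgt IH; apply/negP => /cn.
rewrite add0n s0 ltn0; case: r => [|r] /=; first by rewrite leqNgt cx.
by apply/esym/negP => /cn.
Qed.

Lemma key_shape (g : composition) r :
  row_length (key g) r = nth 0 (decreasing_rearr g) r.
Proof.
set s := decreasing_rearr g; set M := \max_(j < n) g j.
have ss : sorted geq s by apply: sort_sorted => a b /=; exact: leq_total.
have yM : nth 0 s r <= M.
  case: (ltnP r (size s)) => [|h]; last by rewrite nth_default.
  move/(mem_nth 0); rewrite mem_sort => /codomP[j ->].
  exact: (leq_bigmax j).
rewrite /row_length /key -/M count_map.
rewrite (@eq_in_count _ _ (fun c => c <= nth 0 s r)); last first.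
  move=> c; rewrite mem_iota => /andP[c0 _] /=.
  by rewrite count_codom_key_column lt_count_sorted.
move: (nth 0 s r) yM => y yM; rewrite -{1}(subnKC yM) iotaD count_cat.
rewrite (@eq_in_count _ _ predT) ?count_predT ?size_iota; last first.
  by move=> c; rewrite mem_iota add1n ltnS => /andP[_ ->].
rewrite (@eq_in_count _ _ pred0) ?count_pred0 ?addn0 //.
by move=> c; rewrite mem_iota => /andP[+ _] /=; rewrite add1n leqNgt => /negPf.
Qed.

Lemma sorted_key_column (g : composition) c : sorted ltn (key_column g c).
Proof.
rewrite /key_column sorted_map; apply: sorted_filter.
  by move=> a b d /=; exact: ltn_trans.
rewrite (_ : relpre _ ltn = relpre val ltn) // -sorted_map val_enum_ord.
exact: iota_ltn_sorted.
Qed.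

Lemma nth_subseq_sorted (s t : seq nat) r : subseq s t -> sorted ltn t ->
  r < size s -> nth 0 t r <= nth 0 s r.
Proof.
elim: t s r => [|y t IH] s r; first by rewrite subseq0 => /eqP->.
case: s => // x s; rewrite /= => st yt; have tt := path_sorted yt.
case: eqP st => [->|_] st; first by case: r => //= r; exact: IH.
case: r => [|r] rs /=.
  have: x \in t by apply: (mem_subseq st); rewrite mem_head.
  by move/(allP (order_path_min ltn_trans yt))/ltnW.
apply: IH => //; apply: subseq_trans st; exact: subseq_cons.
Qed.

Lemma key_semistandard (g : composition) : semistandard (key g).
Proof.
have sub c d : c <= d -> subseq (key_column g d) (key_column g c).
  move=> cd; apply: map_subseq; rewrite subseq_filter filter_subseq andbT.
  by apply/allP=> j; rewrite mem_filter => /andP[/(leq_trans cd)].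
split=> [C /mapP[c _ ->]|c r]; first exact: sorted_key_column.
case: (ltnP c.+1 (size (key g))) => [cM|cM]; last by rewrite nth_default.
move: cM; rewrite size_map size_iota => cM; have c'M := ltnW cM.
rewrite /key !(nth_map 0) ?size_iota ?nth_iota // => rs.
by apply: nth_subseq_sorted => //; [exact: sub|exact: sorted_key_column].
Qed.

End Compositions.

(* Entrywise comparison; all2 also requires both tableaux to have the same    *)
(* shape.                                                                     *)
Definition tableau_le (T T' : tableau) : bool := all2 (all2 leq) T T'.

Section Fillings.

Variable n : nat.

(* F c lists the entries of column c in rows 1, 2, ...; the basement is not   *)
(* stored.                                                                    *)
Definition filling : Type := {ffun 'I_n -> seq nat}.

Definition empty_filling : filling := [ffun=> [::]].

Definition sh (F : filling) : composition n := [ffun c => size (F c)].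

Definition column (F : filling) (c : 'I_n) : seq nat := c.+1 :: F c.

(* Row 0 is the basement; the value is 0 at empty positions.                  *)
Definition entry (F : filling) (c : 'I_n) (r : nat) : nat :=
  nth 0 (column F c) r.

(* Writes x in row r.+1 of column c, either replacing an entry or, if that    *)
(* column has height r, creating a new cell on top of it.                     *)
Definition put (F : filling) (c : 'I_n) (r x : nat) : filling :=
  [ffun d => if d == c then set_nth 0 (F c) r x else F d].

Definition reading_order (F : filling) : seq ('I_n * nat) :=
  [seq (c, r) | r <- rev (iota 0 (\max_(c < n) size (F c)).+1),
                c <- [seq c <- enum 'I_n | r <= size (F c)]].

(* The scan returns the new filling together with the height of the column    *)
(* where the insertion terminates.  The list of cells may be computed once    *)
(* and for all: the set of cells only changes when the insertion terminates.  *)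
(* If the scan ran out of cells, which does not happen for the insertions     *)
(* performed by Phi, the returned height would be 0.                          *)
Fixpoint scan (cells : seq ('I_n * nat)) (x : nat) (F : filling)
    : filling * nat :=
  if cells is (c, r) :: cells' then
    if (entry F c r < x) || (x <= entry F c r.+1) then scan cells' x F
    else
      let y := entry F c r.+1 in
      let F' := put F c r x in
      if y != 0 then scan cells' y F' else (F', size (F' c))
  else (F, 0).

Definition insertion (k : nat) (F : filling) : filling * nat :=
  scan (reading_order F) k F.

(* Leftmost column of height h - 1 on which i may be placed; if there were    *)
(* none, which does not happen in Phi, G would be left unchanged.             *)
Definition place (i h : nat) (G : filling) : filling :=
  if [seq c <- enum 'I_n |
       ((size (G c)).+1 == h) && sorted geq (rcons (column G c) i)] is c :: _
  then put G c (size (G c)) i else G.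

Definition Phi_step (b : nat * nat) (FG : filling * filling)
    : filling * filling :=
  let: (F, h) := insertion b.2 FG.1 in (F, place b.1 h FG.2).

(* foldr processes the biletters from the last one to the first one.          *)
Definition Phi (w : seq (nat * nat)) : filling * filling :=
  foldr Phi_step (empty_filling, empty_filling) w.

End Fillings.

(* Main.v *)
Require Import Defs.
From mathcomp Require Import all_boot all_fingroup.
From mathcomp Require Import zify.

Set Implicit Arguments.
Unset Strict Implicit.
Unset Printing Implicit Defensive.

(* Writing f and g for the shapes of F and G, the key inequality says that,   *)
(* for all h and t, at most as many of the columns c > t of g have height     *)
(* >= h as of the columns c <= n - t of f ([dominated]).                      *)
(*                                                                            *)
(* Processing a biletter (i, j) adds a cell at some height h to a column p of *)
(* F and to a column q of G.  Since i is at most every entry of G, q is the   *)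
(* leftmost column of g of height h - 1 with q >= i; and p lies to the right  *)
(* of every column of f of height h.  The first fact shows that domination is *)
(* preserved as long as p <= n + 1 - i and f vanishes beyond n + 1 - i, which *)
(* is what i + j <= n + 1 and the lexicographic order give.  The second shows *)
(* that domination after the step implies domination before it.  Finally, if  *)
(* all later biletters obey the bound but j > n + 1 - i, then j opens a new   *)
(* column p > n + 1 - i, while all columns of G are >= i, against domination. *)
(*                                                                            *)
(* The rule for p follows from the non-attacking and triple conditions, which *)
(* insertion preserves.                                                       *)

(** * Insertion in the reading order *)

(** Everything rests on how one biletter changes the two shapes. By [key_leP], comparing the keys
    amounts to [dominated], since increasing sequences of equal length compare entrywise exactly
    when their numbers of entries above every threshold do ([all2_leq_count]). The induction that
    removes the first biletter uses [dominated_step] and [dominated_unstep], which need only the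
    data collected in [rsk_step]. On the side of F these come from [insertion_shape], which relies
    on [skyline_bumped]; on the side of G they come from [place_shape].

    A legal column of G always exists: row bumping ([stops_higher]) lets each top letter open at
    most one column ([nonempty_bound]). The same count keeps G within its first k columns, while F
    stays within its first m columns because a letter j only opens columns whose basement letter is
    at most j. *)

Lemma descending_ind (P : nat -> Prop) N :
  (forall p, N <= p -> P p) -> (forall p, P p.+1 -> P p) -> forall p, P p.
Proof.
move=> PN PS p; have [/PN//|/ltnW pN] := leqP N p.
rewrite -(subKn pN); elim: (N - p) (leq_subr p N) => [|d IH] dN.
  by rewrite subn0; exact: PN.
by apply: PS; rewrite -subSn // subSS; apply: IH; exact: ltnW.
Qed.

Section Linear.

Variable n : nat.

Implicit Types (f X Y : nat -> nat) (x p q : nat).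

(* Cells are numbered from right to left within a row and from the basement   *)
(* upwards: the reading order runs through decreasing positions, the cell     *)
(* above p is p + n, and the cells between p and p + n are exactly those that *)
(* form a triple with them.  The exception in [skyline_triple] is that the    *)
(* column of q is strictly ahead (of p's column) in the order by height, then *)
(* from left to right.                                                        *)
Record skyline f : Prop := Skyline {
  skyline_base p : p < n -> f p = n - p;
  skyline_col p : f (p + n) <= f p;
  skyline_attack p q : p < q < p + n -> 0 < f q -> f p != f q;
  skyline_triple p q : p < q < p + n -> 0 < f q -> f (p + n) <= f q <= f p ->
    exists k, 0 < f (q + k * n) /\ f (p + n + k * n) = 0;
  skyline_supp : exists N, forall p, N <= p -> f p = 0
}.

(* X p.+1 is the value carried by the scan when it reaches position p, and 0  *)
(* once the insertion has terminated.  A cell is only overwritten when the    *)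
(* scan has passed it, so X can be computed from the initial filling alone.   *)
Definition bumps f X p := (X p.+1 <= f p) && (f (p + n) < X p.+1).

Definition carried f x X : Prop :=
  (forall p, X p = if bumps f X p then f (p + n) else X p.+1) /\
  (exists N, forall p, N <= p -> X p = x).

Definition bumped f X p :=
  if (n <= p) && bumps f X (p - n) then X (p - n).+1 else f p.

(** The scan seats its last value on top of cell [t], so the new cell is [t + n]. *)
Definition stops X t := (X t == 0) && (0 < X t.+1).

Lemma bumped_base f X p : p < n -> bumped f X p = f p.
Proof. by move=> pn; rewrite /bumped leqNgt pn. Qed.

Lemma bumpedE f X p :
  bumped f X (p + n) = if bumps f X p then X p.+1 else f (p + n).
Proof. by rewrite /bumped leq_addl addnK. Qed.

Lemma bumped_ge f X p : f p <= bumped f X p.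
Proof.
have [pn|np] := ltnP p n; first by rewrite bumped_base.
rewrite -(subnK np) bumpedE /bumps.
case: ifP => // /andP[_]; exact: ltnW.
Qed.

Lemma col_chain f p j k : (forall p, f (p + n) <= f p) -> j <= k ->
  f (p + k * n) <= f (p + j * n).
Proof.
move=> fc /subnK <-; elim: (k - j) => [|d IH] //.
apply: leq_trans IH; rewrite addSn mulSn [n + _]addnC addnA; exact: fc.
Qed.

(** * The values carried by one scan *)

Section Run.

Variables (f X : nat -> nat) (x : nat).
Hypotheses (fS : skyline f) (fX : carried f x X).

Let fc := skyline_col fS.

Lemma carried_step p : X p = if bumps f X p then f (p + n) else X p.+1.
Proof. by case: fX. Qed.

Lemma carried_bump p : bumps f X p -> X p = f (p + n).
Proof. by rewrite carried_step => ->. Qed.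

Lemma carried_skip p : ~~ bumps f X p -> X p = X p.+1.
Proof. by rewrite carried_step => /negPf->. Qed.

Lemma carried_lt p : bumps f X p -> X p < X p.+1.
Proof. by move=> b; rewrite carried_bump //; case/andP: b. Qed.

Lemma carried_leS p : X p <= X p.+1.
Proof.
have [/carried_lt/ltnW//|/carried_skip->//] := boolP (bumps f X p).
Qed.

Lemma carried_mono p q : p <= q -> X p <= X q.
Proof.
move=> /subnK <-; elim: (q - p) => // d IH.
by apply: leq_trans IH _; exact: carried_leS.
Qed.

Lemma carried_le p : X p <= x.
Proof.
case: fX => _ [N XN]; rewrite -(XN (maxn N p)) ?leq_maxl //.
by apply: carried_mono; exact: leq_maxr.
Qed.

(** A value just bumped out of a cell differs from the cells in between by the non-attacking
    condition. A value cannot pass a cell with the same entry: by induction the cell above holds a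
    smaller one, so the value would be seated there. *)
Lemma carried_fresh p q : p < q <= p + n -> 0 < X p.+1 -> f q != X p.+1.
Proof.
case: fX => _ [N XN]; case: (skyline_supp fS) => N' fN; move: p q.
apply: (@descending_ind _ (maxn N N')) => [p + q pq|p IH q pq].
  by rewrite geq_max => /andP[Np N'p] h; rewrite fN; lia.
have [b|b] := boolP (bumps f X p.+1).
  rewrite carried_bump // => h; case/andP: b; rewrite addSn => b1 b2.
  have [->|qp] := eqVneq q p.+1; first by move: b1 b2; rewrite -addSn; lia.
  apply: (skyline_attack fS) => //; lia.
rewrite (carried_skip b) => h; have [->|qp] := eqVneq q p.+1; last first.
  by apply: IH => //; lia.
apply: contraNneq b => e; rewrite /bumps e leqnn /=.
have := IH (p.+1 + n) _ h; have := fc p.+1; lia.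
Qed.

(** Counterpart of [carried_fresh] one row higher: a match there is the cell that the carried value
    was bumped from, hence already overwritten. *)
Lemma carried_fresh_above p q : p <= q < p + n -> 0 < X p ->
  f (q + n) = X p -> bumps f X q.
Proof.
case: fX => _ [N XN]; case: (skyline_supp fS) => N' fN; move: p q.
apply: (@descending_ind _ (maxn N N')) => [p + q pq|p IH q pq].
  by rewrite geq_max => /andP[Np N'p]; rewrite fN; lia.
have [b|b] := boolP (bumps f X p).
  rewrite carried_bump //; have [->//|qp] := eqVneq q p => h e.
  rewrite -e in h.
  by have := @skyline_attack _ fS (p + n) (q + n) ltac:(lia) h; rewrite e eqxx.
rewrite (carried_skip b) => h e; have [eqp|qp] := eqVneq q p.
  rewrite eqp in e.
  by have := @carried_fresh p (p + n) ltac:(lia) h; rewrite e eqxx.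
by apply: IH => //; lia.
Qed.

(* Whatever the scan carries within one row length of a cell, it does not fit *)
(* strictly above the cell over it and below the cell itself: the value that  *)
(* first crossed the gap would have violated a triple condition.              *)
Lemma carried_gap p q : p <= q < p + n -> ~~ (f (q + n) < X p <= f q).
Proof.
have [m] := ubnP (q - p); elim: m p => // m IH p qpm pq.
have [->|qp] := eqVneq q p.
  have [b|] := boolP (bumps f X p); first by rewrite carried_bump // ltnn.
  by move=> b; rewrite carried_skip // andbC.
have [b|b] := boolP (bumps f X p); last first.
  by rewrite carried_skip //; apply: IH; lia.
apply/negP => /andP[h1 h2].
have h := carried_lt b; case/andP: (b) => b1 b2.
have /negP h3 := IH p.+1 ltac:(lia) ltac:(lia).
have h4 : f q < X p.+1 by lia.
have e := carried_bump b.
(* The two triples claim that each of the two columns is ahead of the other. *)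
have [||k [k1 k2]] := @skyline_triple _ fS q (p + n) ltac:(lia); [lia|lia|].
have [||l [l1 l2]] := @skyline_triple _ fS p q ltac:(lia); [lia|lia|].
have [lk|kl] := leqP l k; first by have := col_chain (p + n) fc lk; lia.
have := col_chain q fc kl; rewrite mulSn addnA; lia.
Qed.

(** If the entry were smaller than its basement letter, the basement cell carrying the same value
    would attack it. *)
Lemma skyline_row1 p : p < n -> 0 < f (p + n) -> f (p + n) = n - p.
Proof.
move=> pn h; have := fc p; rewrite (skyline_base fS pn) => le.
apply/eqP; apply/negPn/negP => ne.
have := @skyline_attack _ fS (n - f (p + n)) (p + n) ltac:(lia) h.
by rewrite (@skyline_base _ fS (n - f (p + n))); lia.
Qed.

Lemma bump_base p : p < n -> bumps f X p -> X p = 0.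
Proof.
move=> pn b; rewrite carried_bump //; apply/eqP; apply/negPn/negP.
rewrite -lt0n => /(skyline_row1 pn) e.
by case/andP: b; rewrite e (skyline_base fS) //; lia.
Qed.

Lemma carried_base p : p <= n -> 0 < X p -> X p = X n.
Proof.
move=> /subKn <-; elim: (n - p) (leq_subr p n) => [|d IH] dn.
  by rewrite subn0.
have e : (n - d.+1).+1 = n - d by lia.
move=> h; have b : ~~ bumps f X (n - d.+1).
  by apply: contraL h => /bump_base->//; lia.
by rewrite (carried_skip b) e in h *; exact: IH (ltnW dn) h.
Qed.

(** * The filling after the insertion *)

Section Stop.

Variable t : nat.
Hypothesis Xt : stops X t.

Lemma stops_gt0 : 0 < X t.+1. Proof. by case/andP: Xt. Qed.

Lemma stops_bump : bumps f X t.
Proof.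
apply/negPn/negP => /carried_skip; case/andP: Xt => /eqP->; lia.
Qed.

Lemma stops_top : f (t + n) = 0.
Proof. by rewrite -(carried_bump stops_bump); case/andP: Xt => /eqP. Qed.

Lemma stops_le : X t.+1 <= f t.
Proof. by case/andP: stops_bump. Qed.

Lemma bump_after p : bumps f X p -> t <= p.
Proof.
move=> /carried_lt h; rewrite leqNgt; apply/negP => pt.
have := carried_mono pt; case/andP: Xt => /eqP->; lia.
Qed.

Lemma bumped_stop : bumped f X (t + n) = X t.+1.
Proof. by rewrite bumpedE stops_bump. Qed.

Lemma bumped_gt0 p : (0 < bumped f X p) = (0 < f p) || (p == t + n).
Proof.
have [->|pt] := eqVneq p (t + n); first by rewrite bumped_stop stops_gt0 orbT.
have [pn|np] := ltnP p n; first by rewrite bumped_base // orbF.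
rewrite orbF -(subnK np) bumpedE; case: ifP => // b.
have ne : X (p - n) != 0.
  apply/eqP => X0; case/eqP: pt; have tp := bump_after b.
  rewrite -(subnK np); congr (_ + n); apply/eqP; rewrite eqn_leq tp andbT.
  rewrite leqNgt; apply/negP => /carried_mono; rewrite X0.
  by have := stops_gt0; lia.
rewrite -carried_bump // [RHS]lt0n ne; have := carried_lt b; lia.
Qed.

Lemma bumped_eq0 p : f p = 0 -> p != t + n -> bumped f X p = 0.
Proof.
by move=> f0 /negPf pt; apply/eqP; rewrite -leqn0 leqNgt bumped_gt0 f0 pt.
Qed.

(** Along the basement the carried value [y] stays constant until the scan stops; were it smaller
    than the letter at [t], it would already have been seated on the basement cell [n - y], whose
    letter is [y]. *)
Lemma stops_base : t < n -> X t.+1 = n - t.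
Proof.
move=> tn; have := stops_le; rewrite (skyline_base fS tn) => le.
have h := stops_gt0; apply/eqP; apply/negPn/negP => ne.
set y := X t.+1 in le h ne *.
have e p : t < p <= n -> X p = y.
  move=> tp; rewrite (carried_base (p := p)); [|lia|].
    by rewrite -(@carried_base t.+1).
  by apply: leq_trans h _; apply: carried_mono; lia.
have b : bumps f X (n - y).
  rewrite /bumps e; last by lia.
  rewrite (@skyline_base _ fS (n - y)) ?subKn; [|lia|lia].
  rewrite leqnn /=.
  have := @carried_fresh (n - y) (n - y + n) ltac:(lia).
  rewrite e; [|lia]; move=> /(_ h).
  by have := fc (n - y); rewrite (@skyline_base _ fS (n - y)); lia.
have := bump_base _ b; rewrite e; lia.
Qed.

Lemma bumped_attack p q : p < q < p + n -> 0 < bumped f X q ->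
  bumped f X p != bumped f X q.
Proof.
move=> pq q0; have [qn|nq] := ltnP q n.
  rewrite !bumped_base ?(skyline_base fS); lia.
have [q' eq] : exists q', q = q' + n by exists (q - n); lia.
subst q; rewrite bumpedE in q0 *.
have [pn|np] := ltnP p n.
  rewrite bumped_base //; case: ifP q0 => b q0.
    by apply: carried_fresh => //; lia.
  by apply: (skyline_attack fS).
have [p' ep] : exists p', p = p' + n by exists (p - n); lia.
subst p; rewrite bumpedE; case: ifP => bp; case: ifP q0 => bq q0.
- have := carried_lt bq; have : X p'.+1 <= X q' by apply: carried_mono; lia.
  lia.
- apply: contraFneq bq => e.
  apply: (@carried_fresh_above p'.+1) => //; [lia|].
  by case/andP: bp; lia.
- by apply: carried_fresh => //; lia.
- by apply: (skyline_attack fS) => //; lia.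
Qed.

Lemma bumped_le p : bumped f X (p + n) <= f p.
Proof. by rewrite bumpedE; case: ifP => [/andP[]|_]. Qed.

(* The column of the new cell overtakes the columns that were just ahead of   *)
(* it; this is what makes the triple conditions survive the change of order.  *)
Lemma overtake p q k : t = p + k * n -> p < q < p + n ->
  0 < f (q + k * n) -> f (q + k.+1 * n) = 0 -> f q < bumped f X (p + n).
Proof.
elim: k p q => [|k IH] p q et pq h1 h2.
  have -> : p = t by lia.
  rewrite bumped_stop; have := @carried_gap t.+1 q ltac:(lia).
  have -> : f (q + n) = 0 by rewrite -h2 mul1n.
  rewrite stops_gt0; lia.
have lt : f (q + n) < f (p + n).
  apply: leq_trans (bumped_le _); apply: IH; rewrite -?addnA -?mulSn //; lia.
apply: leq_trans (bumped_ge _ _ _); rewrite ltnNge; apply/negP => le.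
have [||l [l1 l2]] := @skyline_triple _ fS q (p + n) ltac:(lia); [lia|lia|].
have [kl|lk] := ltnP k l.
  have := stops_top; rewrite et addnAC => top.
  by have := col_chain (p + n) fc kl; rewrite top; lia.
have := col_chain (q + n) fc lk; rewrite mulSn addnA in h1; lia.
Qed.

(** The cases follow which entries are new. A new entry at [q] is excluded by [carried_gap] and the
    strict decrease of bumped values. If [p] and [q] are both old, the old witness survives unless
    its empty cell is the new cell, where [overtake] applies. If only the entry at [p] is new,
    either the old triple still applies or the one a row below does. *)
Lemma bumped_triple p q : p < q < p + n -> 0 < bumped f X q ->
  bumped f X (p + n) <= bumped f X q <= bumped f X p ->
  exists k, 0 < bumped f X (q + k * n) /\ bumped f X (p + n + k * n) = 0.
Proof.
move=> pq q0 /andP[le1 le2].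
have bup k : 0 < f (q + k * n) -> 0 < bumped f X (q + k * n).
  by move=> h; apply: leq_trans h (bumped_ge _ _ _).
have [/andP[nq bq]|/negPf eq] := boolP ((n <= q) && bumps f X (q - n)).
  have [q' ?] : exists q', q = q' + n by exists (q - n); lia.
  subst q; rewrite addnK in bq; rewrite bumpedE bq in q0 le1 le2.
  have lt := carried_lt bq.
  have bpn : ~~ bumps f X p.
    apply/negP => bp; move: le1; rewrite bumpedE bp.
    have := carried_lt bp; have := @carried_mono q'.+1 p ltac:(lia); lia.
  rewrite bumpedE (negPf bpn) in le1.
  have [/andP[np bp]|/negPf ep] := boolP ((n <= p) && bumps f X (p - n)).
    move: le2; rewrite /bumped np bp /=.
    have := @carried_mono (p - n).+1 q' ltac:(lia); lia.
  rewrite /bumped ep in le2.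
  have := @bumped_attack (q' + n) (p + n) ltac:(lia).
  rewrite !bumpedE bq (negPf bpn).
  have := @carried_gap q'.+1 p ltac:(lia).
  have := stops_gt0; have := @carried_mono t.+1 q'.+1 (bump_after bq).
  have [e _ _ _ | ] := eqVneq (X q'.+1) (f (p + n)); last by lia.
  by move=> /(_ ltac:(lia)).
have eqf : bumped f X q = f q by rewrite /bumped eq.
rewrite eqf in q0 le1 le2.
have fle : f (p + n) <= f q by apply: leq_trans le1; exact: bumped_ge.
have [/andP[np bp]|/negPf ep] := boolP ((n <= p) && bumps f X (p - n)); last first.
  have epf : bumped f X p = f p by rewrite /bumped ep.
  rewrite epf in le2.
  have [|k [k1 k2]] := @skyline_triple _ fS p q pq q0; first by rewrite fle.
  have [e|ne] := eqVneq (p + n + k * n) (t + n); last first.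
    by exists k; split; [exact: bup|exact: bumped_eq0].
  have et : t = p + k * n by lia.
  (* The new cell fills the old witness: either the column of [q] is taller still and the witness
     moves up one row, or it has just been overtaken. *)
  have [h0|hpos] := posnP (f (q + k.+1 * n)).
    by have := overtake et pq k1 h0; lia.
  exists k.+1; split; first exact: bup.
  apply: bumped_eq0; last by rewrite et mulSn; lia.
  by apply/eqP; rewrite -leqn0 -k2; apply: col_chain.
have [p' ?] : exists p', p = p' + n by exists (p - n); lia.
subst p; rewrite addnK in bp; rewrite bumpedE bp in le2.
have lt := carried_lt bp; have tp := bump_after bp.
have bpn : ~~ bumps f X (p' + n).
  apply/negP => b; move: le1; rewrite bumpedE b.
  have := carried_lt b; have := @carried_mono p'.+1 (p' + n) ltac:(lia); lia.
have zero k : f (p' + n + n + k * n) = 0 -> bumped f X (p' + n + n + k * n) = 0.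
  by move=> h; apply: bumped_eq0 => //; lia.
have [fq|fp] := leqP (f q) (f (p' + n)).
  have [|k [k1 k2]] := @skyline_triple _ fS (p' + n) q pq q0; first by rewrite fle.
  by exists k; split; [exact: bup|exact: zero].
have [f0|fp0] := posnP (f (p' + n)).
  exists 0; split; first by apply: bup; rewrite addn0.
  by apply: zero; have := fc (p' + n); rewrite f0 addn0; lia.
have [q' ?] : exists q', q = q' + n by exists (q - n); lia.
subst q; rewrite addnK leq_addl /= in eq.
have ne : X p'.+1 != f (q' + n).
  have := @bumped_attack (p' + n) (q' + n) ltac:(lia).
  by rewrite !bumpedE bp eq => /(_ q0).
have gap := @carried_gap p'.+1 q' ltac:(lia).
have fX' : X p'.+1 <= f p' by case/andP: bp.
have xq := @carried_mono p'.+1 q'.+1 ltac:(lia).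
(* The order of the two columns is read off the triple one row lower; its witness is not 0 because
   [p' + n] is nonempty, so it can be shifted down by one. *)
have [||k [k1 k2]] := @skyline_triple _ fS p' q' ltac:(lia).
- by have := fc q'; lia.
- by have := fc q'; move: eq; rewrite /bumps; lia.
case: k k1 k2 => [|k]; first by rewrite mul0n !addn0; lia.
rewrite mulSn !addnA => k1 k2.
by exists k; split; [exact: bup|apply: zero; rewrite -k2; congr f; lia].
Qed.

Lemma skyline_bumped : skyline (bumped f X).
Proof.
split=> [p pn|p|p q|p q|].
- by rewrite bumped_base // (skyline_base fS).
- exact: leq_trans (bumped_le _) (bumped_ge _ _ _).
- exact: bumped_attack.
- exact: bumped_triple.
case: (skyline_supp fS) => N fN; exists (maxn N (t + n).+1) => p.
by rewrite geq_max => /andP[Np tp]; apply: bumped_eq0; [exact: fN|lia].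
Qed.

(** If the column of [q] ended at [q], its entry in the row of [t] and, going down, in every lower
    row would be smaller than the one in the column of [t], since the latter column is not ahead and
    triples forbid the reverse. In the basement this fails, as the column of [q] lies further
    right. *)
Lemma stops_rightmost q : t < q < t + n -> q %/ n = (t %/ n).+1 -> 0 < f q ->
  0 < f (q + n).
Proof.
move=> tq qt q0; rewrite lt0n; apply/negP => /eqP q1.
have lt0 : f q < f t.
  have := @carried_gap t.+1 q ltac:(lia); rewrite q1 stops_gt0.
  have := stops_le; lia.
have n0 : 0 < n by lia.
have H j : j <= t %/ n -> f (q - j.+1 * n) < f (t - j * n).
  elim: j => [|j IH] jt.
    rewrite mul0n mul1n subn0 ltnNge; apply/negP => le.
    have qn : n <= q by rewrite -(mul1n n) -leq_divRL // qt.
    have [|||k [k1 k2]] := @skyline_triple _ fS (q - n) t; [lia|lia| |].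
      by rewrite subnK //; lia.
    case: k k1 k2 => [|k] k1; rewrite subnK ?mul0n ?addn0 //; first by lia.
    have := @col_chain f (t + n) 0 k fc (leq0n _).
    by rewrite mul0n addn0 stops_top; rewrite mulSn addnA in k1; lia.
  have jn : j.+1 * n <= t by rewrite -leq_divRL.
  have jq : j.+2 * n <= q by rewrite -leq_divRL // qt.
  have /IH{}IH : j <= t %/ n by lia.
  have et : t - j.+1 * n + n = t - j * n by move: jn; rewrite mulSn; lia.
  have eq : q - j.+2 * n + n = q - j.+1 * n.
    by move: jq; rewrite [j.+2 * n]mulSn; lia.
  have ft := fc (t - j.+1 * n); rewrite et in ft.
  rewrite ltnNge; apply/negP => le.
  have [|||k [k1 k2]] := @skyline_triple _ fS (q - j.+2 * n) (t - j.+1 * n).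
  - by move: jq jn; rewrite [j.+2 * n]mulSn; lia.
  - by lia.
  - by rewrite eq; lia.
  have [jk|kj] := leqP k j.+1; last first.
    have := col_chain (t - j.+1 * n) fc kj.
    have -> : t - j.+1 * n + j.+2 * n = t + n by rewrite [j.+2 * n]mulSn; lia.
    by rewrite stops_top; lia.
  have := col_chain (q - j.+2 * n + n) fc jk.
  by rewrite k2 eq subnK; [lia|move: jq; rewrite [j.+2 * n]mulSn; lia].
have := H _ (leqnn _); rewrite -qt.
have -> : q - q %/ n * n = q %% n by rewrite {1}(divn_eq q n); lia.
have -> : t - t %/ n * n = t %% n by rewrite {1}(divn_eq t n); lia.
rewrite !(skyline_base fS) ?ltn_mod //.
have := divn_eq q n; have := divn_eq t n; rewrite qt mulSn; lia.
Qed.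

End Stop.

Hypothesis (xn : 0 < x <= n).

(** A value surviving the whole basement would be at most [n], hence would have met the basement
    cell with its own letter and been seated there. *)
Lemma carried_ends : X 0 = 0.
Proof.
apply/eqP; apply/negPn/negP; rewrite -lt0n => h.
have Xp p : 0 < X p by apply: leq_trans h _; exact: carried_mono.
have le : X n <= n by have := carried_le n; lia.
have h' := Xp n.
have pn : n - X n < n by lia.
suff b : bumps f X (n - X n) by have := Xp (n - X n); rewrite bump_base.
have e : X (n - X n).+1 = X n by apply: carried_base.
rewrite /bumps e (skyline_base fS pn) subKn // leqnn /=.
have := @carried_fresh (n - X n) (n - X n + n) ltac:(lia) (Xp _).
rewrite e; have := fc (n - X n); rewrite (skyline_base fS pn); lia.
Qed.

Lemma stops_exists : exists t, stops X t.
Proof.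
case: fX => _ [N XN].
have : exists p, 0 < X p by exists N; rewrite XN; lia.
case/ex_minnP => -[|t] h m; first by have := carried_ends; lia.
exists t; rewrite /stops h andbT; apply/negPn/negP; rewrite -lt0n => /m.
by rewrite ltnn.
Qed.

End Run.

(* Row bumping: a later and smaller letter reaches every cell one row earlier *)
(* than its predecessor, hence stops in a higher row.                         *)
Lemma stops_higher f X Y x y t : skyline f -> carried f x X ->
  carried (bumped f X) y Y -> y <= x -> stops X t -> Y (t + n) = 0.
Proof.
move=> fS fX fY yx Xt; have fc := skyline_col fS.
have H p : 0 < X p -> Y (p + n) <= X p.
  case: (fX) => _ [N XN]; case: (skyline_supp fS) => N' fN; move: p.
  apply: (@descending_ind _ (maxn N N')) => [p + Xp|p IH Xp].
    rewrite geq_max => /andP[Np N'p]; rewrite XN //.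
    apply: leq_trans yx; exact: (carried_le fY).
  have {}IH : Y (p + n).+1 <= X p.+1.
    by apply: IH; apply: leq_trans Xp (carried_leS fX p).
  have [b|b] := boolP (bumps f X p); last first.
    by rewrite (carried_skip fX b); apply: leq_trans (carried_leS fY _) IH.
  rewrite (carried_step fY) /bumps bumpedE b IH /= (carried_bump fX b).
  have le := bumped_le X fS (p + n).
  by case: ltnP => // h; exact: leq_trans h le.
have b := stops_bump fX Xt; have h := stops_gt0 Xt.
have n0 : n != 0.
  by apply/eqP => n0; have := stops_le fX Xt; have := stops_top fX Xt;
    rewrite n0 addn0; lia.
have IH := H _ h; rewrite addSn in IH.
rewrite (carried_step fY) /bumps bumpedE b IH /=.
have -> : bumped f X (t + n + n) = 0.
  apply: (bumped_eq0 fX Xt); last by lia.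
  by have := fc (t + n); rewrite (stops_top fX Xt); lia.
by case: (Y (t + n).+1).
Qed.

End Linear.

(** * From fillings to positions *)

Lemma skyline_ext n f g : f =1 g -> skyline n f -> skyline n g.
Proof.
move=> fg [b c a t [N s]]; split=> [p|p|p q|p q pq|].
- by rewrite -fg; exact: b.
- by rewrite -!fg; exact: c.
- by rewrite -!fg; exact: a.
- rewrite -!fg => h1 h2; have [k [k1 k2]] := t _ _ pq h1 h2.
  by exists k; rewrite -!fg.
- by exists N => p /s; rewrite -fg.
Qed.

Lemma carried_ext n f g x X : f =1 g -> carried n f x X -> carried n g x X.
Proof.
by move=> fg [s e]; split; [move=> p; rewrite s /bumps !fg|].
Qed.

Lemma carried_exists n f x : skyline n f -> exists X, carried n f x X.
Proof.
move=> [_ _ _ _ [N fN]].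
pose st p y := if (y <= f p) && (f (p + n) < y) then f (p + n) else y.
exists (fun p => foldr st x (iota p (N - p))); split=> [p|].
  have [Np|pN] := leqP N p; last by rewrite -(subnSK pN).
  have -> : N - p = 0 by lia.
  have -> : N - p.+1 = 0 by lia.
  rewrite /= /bumps (fN p) ?(fN (p + n)) //; last by lia.
  by rewrite leqn0; case: eqP => [->|].
by exists N => p Np; have -> : N - p = 0 by lia.
Qed.

Lemma stops_unique n f x X t u : carried n f x X -> stops X t -> stops X u ->
  t = u.
Proof.
move=> fX /andP[/eqP t0 t1] /andP[/eqP u0 u1].
case: (ltngtP t u) => // tu; have := carried_mono fX tu; lia.
Qed.

Section Positions.

Variables (n : nat) (n_gt0 : 0 < n).
Implicit Types (F : filling n) (c : 'I_n).

Definition pos c r : nat := r * n + rev_ord c.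

Definition col p : 'I_n := rev_ord (Ordinal (ltn_pmod p n_gt0)).

Definition cell p : 'I_n * nat := (col p, p %/ n).

Definition lin F p : nat := entry F (col p) (p %/ n).

Lemma col_pos c r : col (pos c r) = c.
Proof.
apply: val_inj; rewrite /pos /= modnMDl modn_small; have := ltn_ord c; lia.
Qed.

Lemma pos_div c r : pos c r %/ n = r.
Proof.
rewrite divnMDl // divn_small ?addn0 //; exact: (ltn_ord (rev_ord c)).
Qed.

Lemma cell_pos c r : cell (pos c r) = (c, r).
Proof. by rewrite /cell col_pos pos_div. Qed.

Lemma pos_cell p : pos (col p) (p %/ n) = p.
Proof. by rewrite /pos /col rev_ordK /= -divn_eq. Qed.

Lemma pos_above c r : pos c r.+1 = pos c r + n.
Proof. by rewrite /pos mulSn; lia. Qed.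

Lemma lin_pos F c r : lin F (pos c r) = entry F c r.
Proof. by rewrite /lin col_pos pos_div. Qed.

Lemma lin_above F p : lin F (p + n) = entry F (col p) (p %/ n).+1.
Proof. by rewrite -{1}(pos_cell p) -pos_above lin_pos. Qed.

Definition positive F := forall c r, r <= size (F c) -> 0 < entry F c r.

Lemma entry_gt0 F c r : positive F -> (0 < entry F c r) = (r <= size (F c)).
Proof.
move=> Fp; have [/Fp->//|h] := leqP r (size (F c)).
by rewrite /entry nth_default.
Qed.

Lemma lin_gt0 F p : positive F -> (0 < lin F p) = (p %/ n <= size (F (col p))).
Proof. exact: entry_gt0. Qed.

Lemma entry_put F c r x d s :
  entry (put F c r x) d s = if (d == c) && (s == r.+1) then x else entry F d s.
Proof.
rewrite /entry /column /put ffunE; case: eqP => // <- /=.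
by case: s => //= s; rewrite nth_set_nth /= eqSS.
Qed.

Lemma lin_put F q x p :
  lin (put F (col q) (q %/ n) x) p = if p == q + n then x else lin F p.
Proof.
rewrite /lin entry_put -[in RHS](pos_cell q) -pos_above; congr (if _ then _ else _).
apply/andP/eqP => [[/eqP <- /eqP <-]|->]; first by rewrite pos_cell.
by rewrite col_pos pos_div.
Qed.

Lemma size_put F c r x :
  size (put F c r x c) = maxn r.+1 (size (F c)).
Proof. by rewrite ffunE eqxx size_set_nth. Qed.

Lemma positive_put F c r x : positive F -> 0 < x -> 0 < entry F c r ->
  positive (put F c r x).
Proof.
move=> Fp x0; rewrite entry_gt0 // => rs d s.
rewrite entry_put; have [->|dc] /= := eqVneq d c; last first.
  by rewrite ffunE (negPf dc); exact: Fp.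
rewrite size_put; case: eqP => // sr ss; apply: Fp; lia.
Qed.

Lemma reading_orderE F : positive F ->
  reading_order F = [seq cell p | p <-
    rev (iota 0 ((\max_(c < n) size (F c)).+1 * n)) & 0 < lin F p].
Proof.
move=> Fp; rewrite /reading_order; elim: (_.+1) => [|m IH].
  by rewrite mul0n.
rewrite mulSn addnC iotaD rev_cat filter_cat map_cat -IH.
rewrite -addn1 iotaD /= cats1 rev_rcons /= add0n; congr (_ ++ _).
have -> : rev (iota (0 + m * n) n) = [seq pos c m | c <- enum 'I_n].
  apply: (@eq_from_nth _ 0) => [|i]; rewrite size_rev size_iota.
    by rewrite size_map size_enum_ord.
  move=> i_n; rewrite nth_rev ?size_iota // nth_iota; last by lia.
  rewrite (nth_map (Ordinal i_n)) ?size_enum_ord // /pos /= nth_enum_ord // add0n.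
rewrite filter_map -map_comp; apply: esym.
rewrite (@eq_filter _ _ (fun c : 'I_n => m <= size (F c))); last first.
  by move=> c; rewrite /= lin_pos entry_gt0.
by apply: eq_map => c /=; rewrite cell_pos.
Qed.

(** Seating at cell [p] writes to [p + n] only, so before the scan reaches the cells below [N],
    exactly the positions from [N + n] upwards have their final value. *)
Lemma scan_lin F0 x X t N F : carried n (lin F0) x X ->
  stops X t -> 0 < X N -> positive F ->
  (forall p, lin F p = if p < N + n then lin F0 p else bumped n (lin F0) X p) ->
  let r := scan [seq cell p | p <- rev (iota 0 N) & 0 < lin F0 p] (X N) F in
  [/\ lin r.1 =1 bumped n (lin F0) X, positive r.1 & r.2 = (t %/ n).+1].
Proof.
move=> fX Xt; set f := lin F0.
elim: N F => [|N IH] F XN Fp eF.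
  by have := carried_mono fX (leq0n t); case/andP: Xt => /eqP->; lia.
have eN : lin F N = f N by rewrite eF; case: ifP => //; lia.
have eNn : lin F (N + n) = f (N + n) by rewrite eF; case: ifP => //; lia.
have -> : iota 0 N.+1 = rcons (iota 0 N) N by rewrite -addn1 iotaD /= cats1.
rewrite rev_rcons /=.
have skip : ~~ bumps n f X N -> 0 < X N ->
    forall p, lin F p = if p < N + n then f p else bumped n f X p.
  move=> b XN0 p; rewrite eF addSn ltnS leq_eqVlt.
  have [->|//] := eqVneq p (N + n).
  by rewrite ltnn bumpedE (negPf b).
(* Empty cells are absent from the reading order; they never bump a positive value, so skipping them
   is harmless. *)
have [fN|fN] := posnP (f N).
  have b : ~~ bumps n f X N by rewrite /bumps fN; lia.
  have e := carried_skip fX b; rewrite -e; rewrite -e in XN.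
  by apply: IH => //; exact: skip.
rewrite /= -[entry F _ _]/(lin F N) -lin_above eN eNn.
have [b|b] := boolP (bumps n f X N); last first.
  have e := carried_skip fX b; rewrite -e; rewrite -e in XN.
  rewrite ifT; last by move: b; rewrite /bumps e; lia.
  by apply: IH => //; exact: skip.
case/andP: (b) => b1 b2; rewrite ifF; last by lia.
have Fp' : positive (put F (col N) (N %/ n) (X N.+1)).
  by apply: positive_put => //; rewrite -[entry _ _ _]/(lin F N) eN.
have eF' p : lin (put F (col N) (N %/ n) (X N.+1)) p =
    if p < N + n then f p else bumped n f X p.
  rewrite lin_put; have [->|ne] := eqVneq p (N + n).
    by rewrite ltnn bumpedE b.
  by rewrite eF addSn ltnS leq_eqVlt (negPf ne).
have e : X N = f (N + n) := carried_bump fX b; rewrite -e.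
have [X0|XN0] := eqVneq (X N) 0; last by apply: IH; rewrite ?lt0n.
have Nt : N = t by apply: (stops_unique fX) => //; rewrite /stops X0 XN.
split=> //=.
  move=> p; rewrite eF'; case: ifP => // pN; rewrite /bumped.
  case: ifP => // /andP[np b']; have := bump_after fX Xt b'; lia.
rewrite size_put -Nt; apply/maxn_idPl; apply: leqW.
by rewrite leqNgt -entry_gt0 // -lin_above eNn -e X0.
Qed.

(** The semi-skyline augmented fillings, in which 0 marks exactly the empty positions. *)
Definition ssaf F := positive F /\ skyline n (lin F).

Lemma insertionP F x : ssaf F -> 0 < x <= n -> exists F' X t,
  [/\ insertion x F = (F', (t %/ n).+1), carried n (lin F) x X, stops X t,
      lin F' =1 bumped n (lin F) X & ssaf F'].
Proof.
move=> [Fp FS] xn; have [X fX] := carried_exists x FS.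
have [t Xt] := stops_exists FS fX xn.
set N := (\max_(c < n) size (F c)).+1 * n.
have fN p : N <= p -> lin F p = 0.
  move=> Np; apply/eqP; rewrite -leqn0 leqNgt lin_gt0 // -ltnNge.
  by rewrite -(leq_divRL _ _ n_gt0) in Np; apply: leq_trans Np;
    rewrite ltnS (@leq_bigmax _ (fun c => size (F c))).
have XN : X N = x.
  case: (fX) => _ [M XM]; have [MN|/ltnW NM] := leqP M N; first exact: XM.
  rewrite -(XM M) //; move: NM => /subnKC <-.
  elim: (M - N) => [|d IH]; first by rewrite addn0.
  rewrite IH addnS; apply: (carried_skip fX); rewrite /bumps fN ?leq_addr //.
  have := carried_mono fX (leq_addr d N); rewrite IH; lia.
have [|||e1 e2 e3] := @scan_lin F x X t N F fX Xt; rewrite ?XN //.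
- by lia.
- move=> p; case: ltnP => // Np; rewrite /bumped.
  case: ifP => // /andP[np /andP[]]; rewrite fN; last by lia.
  by move=> h1 h2; lia.
move: e1 e2 e3; rewrite XN /insertion reading_orderE // -/N.
case: scan => F' h /= e1 e2 e3; exists F', X, t; rewrite e3.
split=> //; split=> //; apply: skyline_ext (skyline_bumped FS fX Xt).
by move=> p; rewrite e1.
Qed.

Lemma insertion_higher F x y F1 h1 F2 h2 : ssaf F -> 0 < x <= n ->
  0 < y <= x -> insertion x F = (F1, h1) -> insertion y F1 = (F2, h2) -> h1 < h2.
Proof.
move=> FS xn yx; have [F' [X [t [-> fX Xt e FS']]]] := insertionP FS xn.
case=> <- <-; have yn : 0 < y <= n by lia.
have [F'' [Y [u [-> fY Yu _ _]]]] := insertionP FS' yn.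
case=> _ <-; rewrite ltnS; have n0 := n_gt0.
have fY' := carried_ext e fY.
have Y0 := stops_higher FS.2 fX fY' (proj2 (andP yx)) Xt.
have tu : t + n <= u.
  rewrite leqNgt; apply/negP => ut; have := carried_mono fY ut.
  by rewrite Y0; have := stops_gt0 Yu; lia.
by have := leq_div2r n tu; rewrite divnDr // divnn n_gt0; lia.
Qed.

(** Gathers all that the rest of the proof uses about the shape of F. Indices are 0-based, so
    [c < x] says that the basement letter of the new column is at most [x]. *)
Lemma insertion_shape F x : ssaf F -> 0 < x <= n -> exists F' (c : 'I_n),
  [/\ insertion x F = (F', (size (F c)).+1), ssaf F',
      forall d, size (F' d) = size (F d) + (d == c),
      forall d : 'I_n, c < d -> size (F d) != (size (F c)).+1 &
      (size (F c) = 0 -> c < x) /\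
      (forall m, (forall d : 'I_n, m <= d -> size (F d) = 0) -> m < x -> m <= c)].
Proof.
move=> FS xn; have [F' [X [t [eF fX Xt e FS']]]] := insertionP FS xn.
have [Fp Fl] := FS; have [Fp' Fl'] := FS'.
have top := stops_top fX Xt; have le := stops_le fX Xt.
have gt := stops_gt0 Xt.
have sz : size (F (col t)) = t %/ n.
  apply/eqP; rewrite eqn_leq -(lin_gt0 _ Fp) (leq_trans gt le) andbT.
  by rewrite leqNgt -entry_gt0 // -lin_above top.
have sh' d : size (F' d) = size (F d) + (d == col t).
  apply/eqP; have E r : (r <= size (F' d)) =
      (r <= size (F d)) || (d == col t) && (r == (t %/ n).+1).
    rewrite -!entry_gt0 // -!lin_pos e (bumped_gt0 fX Xt); congr (_ || _).
    have -> : t + n = pos (col t) (t %/ n).+1 by rewrite pos_above pos_cell.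
    apply/eqP/andP => [h|[/eqP-> /eqP->] //].
    have := congr1 col h; have := congr1 (fun p => p %/ n) h.
    by rewrite !pos_div !col_pos => -> ->.
  case: eqP E => [->|_] /= E.
    rewrite addn1 eqn_leq E sz eqxx orbT andbT.
    by have := E (size (F' (col t))); rewrite leqnn sz; lia.
  rewrite addn0 eqn_leq; have := E (size (F d)); have := E (size (F' d)).
  by rewrite !orbF !leqnn => <- ->.
exists F', (col t); split=> //.
- by rewrite eF sz.
- move=> d td; rewrite sz; apply/eqP => sd.
  pose q := pos d (t %/ n).+1.
  have tq : t < q < t + n.
    move: (pos_cell t) td; rewrite /q pos_above /pos /=.
    have := ltn_ord d; have := ltn_pmod t n_gt0; lia.
  have := stops_rightmost Fl fX Xt tq.
  by rewrite pos_div -pos_above !lin_pos !entry_gt0 // sd leqnn ltnn => /(_ erefl erefl).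
have ct : t < n -> col t = n - t.+1 :> nat by move=> tn /=; rewrite modn_small.
split=> [s0|m Fm mx].
  have tn : t < n by rewrite ltnNge -divn_gt0 // -sz s0.
  have := stops_base Fl fX Xt tn; have := carried_le fX t.+1.
  rewrite ct //; lia.
(* All entries above the basement are at most [m < x], so [x] reaches the basement unchanged. *)
have X_n p : n <= p -> X p = x.
  case: (fX) => _ [N XN]; move: p.
  apply: (@descending_ind _ N) => [p Np _|p IH np]; first exact: XN.
  have b : ~~ bumps n (lin F) X p.
    rewrite /bumps IH; last by lia.
    suff : lin F p <= m by lia.
    have [->//|h] := posnP (lin F p).
    have cm : col p < m.
      rewrite ltnNge; apply/negP => /Fm s0; move: h; rewrite lin_gt0 // s0.
      by have := divn_gt0 p n_gt0; rewrite np; lia.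
    have := @col_chain n (lin F) (pos (col p) 0) 0 (p %/ n) (skyline_col Fl) (leq0n _).
    rewrite mul0n addn0 lin_pos.
    have -> : pos (col p) 0 + p %/ n * n = p.
      by rewrite -[RHS](pos_cell p) /pos mul0n addnC.
    have -> : entry F (col p) 0 = (col p).+1 by [].
    by lia.
  by rewrite (carried_skip fX b) IH //; lia.
have tn : t < n.
  rewrite ltnNge; apply/negP => /X_n e0; move: Xt; rewrite /stops e0; lia.
have := @carried_base n (lin F) X x Fl fX t.+1 tn gt; rewrite (X_n n) // => et.
move: le; rewrite et (skyline_base Fl tn) ct //; lia.
Qed.

End Positions.

(** * Keys as counting inequalities *)

Section Counting.

Variable n : nat.
Implicit Types (P Q : pred 'I_n) (f g : composition n) (h l t : nat).

Definition cnt P f h : nat := \sum_(c < n | P c) (h <= f c).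

Definition exact P f l : nat := \sum_(c < n | P c) (f c == l).

Lemma cntS P f h : cnt P f h = cnt P f h.+1 + exact P f h.
Proof.
rewrite /cnt /exact -big_split; apply: eq_bigr => c _ /=.
by case: ltngtP.
Qed.

Lemma eq_cnt P Q f h : (forall c, h <= f c -> P c = Q c) -> cnt P f h = cnt Q f h.
Proof.
move=> e; rewrite /cnt big_mkcond [RHS]big_mkcond; apply: eq_bigr => c _.
by have := e c; case: (h <= f c) => [->//|_]; case: (P c); case: (Q c).
Qed.

Lemma eq_exact P Q f l : (forall c, f c = l -> P c = Q c) ->
  exact P f l = exact Q f l.
Proof.
move=> e; rewrite /exact big_mkcond [RHS]big_mkcond; apply: eq_bigr => c _.
by have := e c; case: eqP => [?->//|_ _]; case: (P c); case: (Q c).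
Qed.

Lemma leq_exact P Q f l : (forall c, P c -> Q c) -> exact P f l <= exact Q f l.
Proof.
move=> PQ; rewrite /exact big_mkcond [leqRHS]big_mkcond; apply: leq_sum => c _.
by have := PQ c; case: (P c) => [->|].
Qed.

Lemma ltn_exact P Q f l p : (forall c, P c -> Q c) -> Q p -> ~~ P p -> f p = l ->
  exact P f l < exact Q f l.
Proof.
move=> PQ Qp Pp fp; rewrite /exact [ltnRHS](bigD1 p) //= fp eqxx add1n ltnS.
rewrite big_mkcond [leqRHS]big_mkcond; apply: leq_sum => c _.
have [->|_] := eqVneq c p; first by rewrite (negPf Pp).
by have := PQ c; case: (P c) => [->|].
Qed.

Lemma exact_gt0 f l c : f c = l -> 0 < exact predT f l.
Proof. by move=> fc; rewrite /exact (bigD1 c) //= fc eqxx. Qed.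

Lemma exact_witness P f l : 0 < exact P f l -> exists c, f c = l.
Proof.
have [/existsP[c /eqP fc] _|/existsPn h] := boolP [exists c, f c == l].
  by exists c.
by rewrite /exact big1 // => c _; rewrite (negPf (h c)).
Qed.

Lemma cnt_add P f f' p h : (forall c, f' c = f c + (c == p)) ->
  cnt P f' h = cnt P f h + (P p && (h == (f p).+1)).
Proof.
move=> e; rewrite /cnt.
rewrite (eq_bigr (fun c => (h <= f c) + ((c == p) && (h == (f p).+1)))).
  rewrite big_split /=; congr (_ + _); have [Pp|Pp] /= := boolP (P p).
    by rewrite (bigD1 p) //= eqxx big1 ?addn0 // => c /andP[_ /negPf->].
  rewrite big1 // => c Pc; have [e'|//] := eqVneq c p.
  by rewrite e' (negPf Pp) in Pc.
move=> c _; rewrite e; have [->|] /= := eqVneq c p; last by rewrite !addn0.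
by rewrite addn1; case: ltngtP => /=; lia.
Qed.

Lemma cnt0_rev f g t :
  cnt (fun c => t <= c) g 0 = cnt (fun c => c < n - t) f 0.
Proof.
rewrite /cnt (reindex_inj rev_ord_inj) /=; apply: eq_bigl => c.
by have := ltn_ord c; lia.
Qed.

Lemma leq_cnt1 f a b : b <= n -> (forall c : 'I_n, a <= c < b -> 0 < f c) ->
  b - a <= cnt predT f 1.
Proof.
move=> bn fab; have -> : b - a = \sum_(a <= c < b) 1.
  by rewrite sum_nat_const_nat muln1.
rewrite (big_nat_widen _ _ n) // big_geq_mkord /cnt big_mkcond.
apply: leq_sum => c _ /=.
by case: ifP => // /andP[cb ac]; rewrite fab // ac.
Qed.

Definition dominated f g : Prop := forall h t,
  cnt (fun c => t <= c) g h <= cnt (fun c => c < n - t) f h.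

Lemma equi_exact f g l : (forall h, cnt predT f h = cnt predT g h) ->
  exact predT f l = exact predT g l.
Proof. by move=> e; have := cntS predT f l; rewrite !e cntS; lia. Qed.

(** * Domination under one step on the shapes *)

Section Step.

Variables (f g f' g' : composition n) (p q : 'I_n).
Hypothesis fp : forall c, f' c = f c + (c == p).
Hypothesis gq : forall c, g' c = g c + (c == q).
Hypothesis pq : f p = g q.
Hypothesis equi : forall h, cnt predT f h = cnt predT g h.

Lemma equi_step h : cnt predT f' h = cnt predT g' h.
Proof. by rewrite (cnt_add _ _ fp) (cnt_add _ _ gq) equi pq. Qed.

(** Only height [(g q).+1] with [t <= q] and [n - t <= p] is at risk. At height [g q], the count of
    g from [t] on already includes all columns of that exact height from [i] on, while the count of
    f below [n - t] misses column [p]; this slack of one passes to the next height. *)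
Lemma dominated_step i : i <= q -> (forall c : 'I_n, c < i -> g c = 0) ->
    (forall c : 'I_n, i <= c < q -> g c != g q) ->
    (forall c : 'I_n, n - i <= c -> f c = 0) -> p < n - i ->
  dominated f g -> dominated f' g'.
Proof.
move=> iq gi gl fi pi D h t; rewrite (cnt_add _ _ fp) (cnt_add _ _ gq) pq.
have [->|_] := eqVneq h (g q).+1; last by rewrite !andbF !addn0.
rewrite !andbT; have := D (g q).+1 t.
have [pt|tp] := ltnP p (n - t); first by case: (t <= q); lia.
have [tq|] := leqP t q; last by lia.
have same j : cnt (fun c => i <= c) g j = cnt (fun c => c < n - i) f j.
  case: j => [|j]; first exact: cnt0_rev.
  rewrite (@eq_cnt _ predT) => [|c]; last by case: (leqP i c) => // /gi ->.
  by rewrite -equi; apply: eq_cnt => c; case: (leqP (n - i) c) => // /fi ->.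
have := D (g q) t; have := same (g q); rewrite !(cntS _ _ (g q)) same.
have -> : exact (fun c => t <= c) g (g q) = exact (fun c => i <= c) g (g q).
  by apply: eq_exact => c gc; have := gl c; rewrite gc eqxx; lia.
have := @ltn_exact (fun c => c < n - t) (fun c => c < n - i) f (g q) p.
by move=> /(_ _ pi _ pq) lt e1 e2 e3; have := lt ltac:(lia) ltac:(lia); lia.
Qed.

(** Only height [(f p).+1] with [p < n - t] could lose. There the inequality one height up is
    unchanged by the step, and all columns of f of height exactly [(f p).+1] lie left of [n - t], as
    many as g has in total. *)
Lemma dominated_unstep : (forall c : 'I_n, p < c -> f c != (f p).+1) ->
  dominated f' g' -> dominated f g.
Proof.
move=> fr D h t; have := D h t; rewrite (cnt_add _ _ fp) (cnt_add _ _ gq) -pq.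
have [->|_] := eqVneq h (f p).+1; last by rewrite !andbF !addn0.
rewrite !andbT; have [pt _|_] := ltnP p (n - t); last by lia.
have := D (f p).+2 t; rewrite (cnt_add _ _ fp) (cnt_add _ _ gq) -pq.
have -> : ((f p).+2 == (f p).+1) = false by lia.
rewrite !andbF !addn0 !(cntS _ _ (f p).+1).
have -> : exact (fun c => c < n - t) f (f p).+1 = exact predT f (f p).+1.
  by apply: eq_exact => c fc /=; have := fr c; rewrite fc eqxx; lia.
rewrite (equi_exact _ equi); have := @leq_exact (fun c => t <= c) predT g (f p).+1.
by move=> /(_ ltac:(by [])); lia.
Qed.

End Step.

End Counting.

Lemma all2_leq_count (s t : seq nat) : sorted ltn s -> sorted ltn t ->
    size s = size t ->
  all2 leq s t <-> forall x, count (leq x) s <= count (leq x) t.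
Proof.
elim: s t => [|a s IH] [|b t] //= sa tb [st].
have as' := order_path_min ltn_trans sa; have bt := order_path_min ltn_trans tb.
have {}IH := IH t (path_sorted sa) (path_sorted tb) st.
have full x y r : x <= y -> all (ltn y) r -> count (leq x) r = size r.
  move=> xy /allP yr; apply/eqP; rewrite -all_count; apply/allP => z /yr /=.
  by move=> /ltnW; exact: leq_trans.
split=> [/andP[ab /IH{}IH] x|H].
  apply: leq_add => //.
  by case: (leqP x a) => // xa; rewrite (leq_trans xa ab).
have ab : a <= b.
  rewrite leqNgt; apply/negP => ba; have := H a.
  have -> : (a <= b) = false by lia.
  by rewrite (full a a s) // leqnn st; have := count_size (leq a) t; lia.
rewrite ab; apply/IH => x; have := H x; have := count_size (leq x) s.
have [xb|bx] := leqP x b; last by rewrite [x <= a]leqNgt (leq_ltn_trans ab bx).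
by rewrite (full x b t xb bt) -st => ->.
Qed.

Lemma all2_map (S T : Type) (r : T -> T -> bool) (A B : S -> T) (s : seq S) :
  all2 r (map A s) (map B s) = all (fun x => r (A x) (B x)) s.
Proof. by elim: s => //= x s ->. Qed.

Section Keys.

Variable n : nat.
Implicit Types f g : composition n.

Lemma permute_longest f c : permute (longest n) f c = f (rev_ord c).
Proof.
rewrite ffunE; congr (f _); apply: (@perm_inj _ (longest n)).
by rewrite permKV permE rev_ordK.
Qed.

Lemma count_key_column f h x :
  count (leq x) (key_column f h) = cnt (fun c : 'I_n => x <= c.+1) f h.
Proof.
rewrite /key_column count_map count_filter -sum1_count big_enum_cond /=.
by rewrite /cnt big_mkcond [RHS]big_mkcond; apply: eq_bigr => c _ /=;
  case: (x <= _) (h <= _) => [] [].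
Qed.

Lemma size_key_column f h : size (key_column f h) = cnt predT f h.
Proof.
by rewrite -(count_predT (key_column f h)) -[RHS](count_key_column f h 0).
Qed.

Lemma bigmax_cnt f h : 0 < h -> (h <= \max_(c < n) f c) = (0 < cnt predT f h).
Proof.
move=> h0; apply/idP/idP => [|].
  apply: contraTT; rewrite -leqNgt leqn0 => /eqP c0; rewrite -ltnNge.
  rewrite -(prednK h0) ltnS; apply/bigmax_leqP => c _.
  rewrite -ltnS prednK // ltnNge; apply: contra_eqN c0 => hc.
  by rewrite /cnt (bigD1 c) //= hc.
apply: contraTT; rewrite -ltnNge -leqNgt leqn0 => m.
rewrite /cnt big1 // => c _; apply/eqP; rewrite eqb0 -ltnNge.
exact: leq_ltn_trans (leq_bigmax c) m.
Qed.

Lemma key_leP f g : (forall h, cnt predT f h = cnt predT g h) ->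
  tableau_le (key g) (key (permute (longest n) f)) <-> dominated f g.
Proof.
move=> e; set f' := permute _ f.
have rev (P : pred 'I_n) h : cnt P f' h = cnt (fun c => P (rev_ord c)) f h.
  rewrite /cnt (reindex_inj rev_ord_inj) /=; apply: eq_bigr => c _.
  by rewrite permute_longest rev_ordK.
have e' h : cnt predT f' h = cnt predT g h by rewrite rev -e.
have em : \max_(c < n) f' c = \max_(c < n) g c.
  have H h : (h <= \max_(c < n) f' c) = (h <= \max_(c < n) g c).
    by case: h => // h; rewrite !bigmax_cnt // e'.
  by apply/eqP; rewrite eqn_leq -H leqnn H leqnn.
have cond h : all2 leq (key_column g h) (key_column f' h) <->
    forall t, cnt (fun c => t <= c) g h <= cnt (fun c => c < n - t) f h.
  rewrite all2_leq_count ?sorted_key_column ?size_key_column //.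
  have shift t : cnt (fun c => t < c.+1) f' h = cnt (fun c => c < n - t) f h.
    by rewrite rev; apply: eq_cnt => c _ /=; have := ltn_ord c; lia.
  split=> [H t|H [|t]].
  - by have := H t.+1; rewrite !count_key_column shift; apply.
  - rewrite !count_key_column.
    have := e' h; rewrite /cnt => ->; exact: leqnn.
  - rewrite !count_key_column shift; exact: H.
rewrite /tableau_le /key em all2_map; split=> [/allP H h t|D].
  (* Height 0 is not a column of the key; both counts are then equal by reflection. *)
  case: h => [|h]; first by rewrite (cnt0_rev f).
  have [hm|mh] := leqP h.+1 (\max_(c < n) g c).
    by apply: (proj1 (cond h.+1)); apply: H; rewrite mem_iota add1n ltnS.
  have : cnt predT g h.+1 = 0.
    by apply/eqP; rewrite -leqn0 leqNgt -bigmax_cnt // -ltnNge.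
  rewrite (@eq_cnt _ _ predT) => [->//|c hc].
  by have := leq_trans hc (leq_bigmax c); rewrite leqNgt mh.
by apply/allP => h _; apply/cond; exact: D.
Qed.

End Keys.

(** * The map Phi *)

Section RSK.

Variables (n : nat) (n_gt0 : 0 < n).
Implicit Types (F G : filling n) (c : 'I_n) (w : seq (nat * nat)).

Lemma shE F c : sh F c = size (F c). Proof. by rewrite ffunE. Qed.

Definition placeable i G : Prop :=
  forall c, sorted geq (column G c) /\ all (leq i) (G c).

Lemma placeable_leq i G c : placeable i G -> 0 < size (G c) -> i <= c.+1.
Proof.
by case/(_ c); rewrite /column; case: (G c) => //= x s /andP[xc _] /andP[ix _] _;
  exact: leq_trans ix xc.
Qed.

Lemma sorted_rcons_column i G c : placeable i G ->
  sorted geq (rcons (column G c) i) = (i <= c.+1).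
Proof.
move=> Gi; have [Gs Ga] := Gi c; rewrite /column /= rcons_path.
have -> /= : path geq c.+1 (G c) by exact: Gs.
have := @placeable_leq i G c Gi; case/lastP: (G c) Ga => [|s x] //=.
rewrite last_rcons all_rcons size_rcons => /andP[ix _] /(_ isT) ->; exact: ix.
Qed.

Lemma filter_enum_head (a : pred 'I_n) c : a c -> exists q s,
  [/\ [seq c <- enum 'I_n | a c] = q :: s, a q & forall d, a d -> q <= d].
Proof.
move=> ac; have: c \in [seq c <- enum 'I_n | a c] by rewrite mem_filter ac mem_enum.
have: sorted (relpre val leq) [seq c <- enum 'I_n | a c].
  apply: sorted_filter; first by move=> x y z; exact: leq_trans.
  rewrite -sorted_map val_enum_ord; exact: iota_sorted.
case e: [seq c <- enum 'I_n | a c] => [|q s] // ss _; exists q, s.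
have aq d : (d \in q :: s) = a d by rewrite -e mem_filter mem_enum andbT.
split=> //; first by rewrite -aq mem_head.
move=> d; rewrite -aq inE => /predU1P[->//|ds].
have tr : transitive (relpre (val : 'I_n -> nat) leq).
  by move=> x y z; exact: leq_trans.
exact: (allP (order_path_min tr ss) d ds).
Qed.

Lemma place_shape i l G c : 0 < i -> placeable i G -> size (G c) = l ->
  i <= c.+1 -> exists q : 'I_n,
  [/\ size (G q) = l, i <= q.+1,
      forall d : 'I_n, i <= d.+1 -> d < q -> size (G d) != l,
      forall d, size (place i l.+1 G d) = size (G d) + (d == q) &
      placeable i (place i l.+1 G)].
Proof.
move=> i0 Gi sc ic.
pose a d := ((size (G d)).+1 == l.+1) && sorted geq (rcons (column G d) i).
have aE d : a d = (size (G d) == l) && (i <= d.+1).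
  by rewrite /a eqSS sorted_rcons_column.
have [|q [s [e aq qmin]]] := @filter_enum_head a c; first by rewrite aE sc eqxx.
have pE : place i l.+1 G = put G q l i.
  by rewrite /place e; move: aq; rewrite aE => /andP[/eqP-> _].
have gq : put G q l i q = rcons (G q) i.
  move: aq; rewrite aE ffunE eqxx => /andP[/eqP<- _].
  by rewrite set_nthE ltnn subnn cats1.
have [Gl iq] : size (G q) = l /\ i <= q.+1.
  by move: aq; rewrite aE => /andP[/eqP].
exists q; split=> // [d id dq|d|d].
- apply/eqP => sd; have /qmin : a d by rewrite aE sd eqxx.
  by rewrite leqNgt dq.
- rewrite pE; have [->|dq] := eqVneq d q; first by rewrite gq size_rcons addn1.
  by rewrite ffunE (negPf dq) addn0.
rewrite pE; have [->|dq] := eqVneq d q; last first.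
  by rewrite /column ffunE (negPf dq); exact: Gi.
rewrite /column gq all_rcons leqnn -rcons_cons; have [_ ->] := Gi q.
by split=> //; rewrite sorted_rcons_column.
Qed.

Lemma ssaf_empty : ssaf n_gt0 (empty_filling n).
Proof.
have E c r : entry (empty_filling n) c r = if r == 0 then c.+1 else 0.
  by rewrite /entry /column ffunE; case: r => [|[]].
have base p : lin n_gt0 (empty_filling n) p = if p < n then n - p else 0.
  rewrite /lin E -leqn0 -ltnS ltn_divLR // mul1n.
  by case: ltnP => // pn /=; rewrite modn_small //; lia.
split; first by move=> c r; rewrite E ffunE leqn0 => ->.
split=> [p pn|p|p q pq|p q pq|].
- by rewrite base pn.
- by rewrite base ltnNge leq_addl.
- by rewrite !base; case: (ltnP q n) => // qn; case: (ltnP p n); lia.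
- by move=> q0 _; exists 0; rewrite mul0n !addn0 q0 base ltnNge leq_addl.
by exists n => p np; rewrite base ltnNge np.
Qed.

Lemma Phi_consE i j w : Phi n ((i, j) :: w) =
  ((insertion j (Phi n w).1).1,
   place i (insertion j (Phi n w).1).2 (Phi n w).2).
Proof. by rewrite /Phi /= /Phi_step /=; case: insertion. Qed.

Definition letters w := all (fun b => letter n b.1 && letter n b.2) w.

Lemma Phi_ssaf w : letters w -> ssaf n_gt0 (Phi n w).1.
Proof.
elim: w => [_|[i j] w IH]; first exact: ssaf_empty.
case/andP=> /andP[_ jn] /IH Fs; rewrite Phi_consE /=.
by have [F' [p [-> Fs' _ _ _]]] := insertion_shape Fs jn.
Qed.

Lemma biword_cons i j w : biword n ((i, j) :: w) ->
  [/\ letter n i, letter n j, biword n w, letters w &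
      forall b, b \in w -> (i < b.1) || (i == b.1) && (j <= b.2)].
Proof.
rewrite /biword /= => /andP[/andP[/andP[-> ->] lw] sw].
rewrite lw /= (path_sorted sw); split=> // b bw.
have tr : transitive lex_le.
  move=> [a1 a2] [b1 b2] [c1 c2]; rewrite /lex_le /=; lia.
exact: (allP (order_path_min tr sw) b bw).
Qed.

(* Equal top letters never contribute twice to the bottom row.                *)
Lemma nonempty_bound i j w k : biword n ((i, j) :: w) ->
    (forall b, b \in (i, j) :: w -> b.1 <= k) ->
  cnt predT (sh (Phi n ((i, j) :: w)).1) 1 + i <= k.+1.
Proof.
elim: w i j => [|[i1 j1] w IH] i j bw bk.
  have [i_n jn _ _ _] := biword_cons bw.
  have [F' [p [e _ sF _ _]]] := insertion_shape ssaf_empty jn.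
  rewrite Phi_consE /= e /=.
  rewrite (@cnt_add _ _ (sh (empty_filling n)) _ p) => [|c]; last by rewrite !shE sF.
  rewrite /cnt big1 => [|c _]; last by rewrite shE ffunE.
  by have := bk (i, j) (mem_head _ _); case: eqP => /=; lia.
have [i_n jn bw1 lw1 /(_ (i1, j1) (mem_head _ _)) lex] := biword_cons bw.
have {}IH : cnt predT (sh (Phi n ((i1, j1) :: w)).1) 1 + i1 <= k.+1.
  by apply: IH => // b bw'; apply: bk; rewrite inE bw' orbT.
have [_ j1n _ lw _] := biword_cons bw1.
have [F1 [p1 [e1 Fs1 sF1 _ _]]] := insertion_shape (Phi_ssaf lw) j1n.
have eF1 : (Phi n ((i1, j1) :: w)).1 = F1 by rewrite Phi_consE e1.
have [F2 [p2 [e2 _ sF2 _ _]]] := insertion_shape Fs1 jn.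
rewrite eF1 in IH; rewrite Phi_consE eF1 e2 /=.
rewrite (@cnt_add _ _ (sh F1) _ p2) => [|c]; last by rewrite !shE sF2.
move: lex => /= /orP[lt|/andP[/eqP ii jj]].
  by case: eqP; lia.
have := @insertion_higher _ n_gt0 _ _ _ _ _ _ _ (Phi_ssaf lw) j1n _ e1 e2.
by rewrite -ii in IH; rewrite shE; move=> /(_ ltac:(move: jn; rewrite /letter; lia)); lia.
Qed.

Record rsk_step i j (f g f' g' : composition n) (p q : 'I_n) : Prop := RskStep {
  step_f c : f' c = f c + (c == p);
  step_g c : g' c = g c + (c == q);
  step_pq : f p = g q;
  step_iq : i <= q.+1;
  step_g0 c : c.+1 < i -> g c = 0;
  step_leftmost c : i <= c.+1 -> c < q -> g c != g q;
  step_rightmost c : p < c -> f c != (f p).+1;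
  step_base : f p = 0 -> p < j;
  step_big m : (forall d : 'I_n, m <= d -> f d = 0) -> m < j -> m <= p
}.

(** The last clause is stated for every lower bound of the top row, so that it serves for whichever
    letter is recorded next. *)
Definition rsk_inv w FG : Prop :=
  [/\ ssaf n_gt0 FG.1,
      forall h, cnt predT (sh FG.1) h = cnt predT (sh FG.2) h &
      forall i, (forall b, b \in w -> i <= b.1) -> placeable i FG.2].

Lemma Phi_step_inv i j w : biword n ((i, j) :: w) -> rsk_inv w (Phi n w) ->
  rsk_inv ((i, j) :: w) (Phi n ((i, j) :: w)) /\
  exists p q, rsk_step i j (sh (Phi n w).1) (sh (Phi n w).2)
    (sh (Phi n ((i, j) :: w)).1) (sh (Phi n ((i, j) :: w)).2) p q.
Proof.
move=> bw [Fs eq Gw]; have [i_n jn bw' lw lex] := biword_cons bw.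
have iw b : b \in w -> i <= b.1 by move=> /lex; lia.
have Gi := Gw i iw.
have [F' [p [eF Fs' sF Fr [Fb Fm]]]] := insertion_shape Fs jn.
have nb := nonempty_bound (k := n) bw.
(* A column of positive height is found in G by equality of the two height counts, and its basement
   letter is automatically at least [i]. An empty one exists among the columns from [i] on by
   [nonempty_bound]. *)
have [c [sc ic]] : exists c, size ((Phi n w).2 c) = size ((Phi n w).1 p) /\ i <= c.+1.
  have [s0|s0] := posnP (size ((Phi n w).1 p)); last first.
    have : 0 < exact predT (sh (Phi n w).1) (size ((Phi n w).1 p)).
      by apply: (@exact_gt0 _ _ _ p); rewrite shE.
    rewrite (equi_exact _ eq) => /exact_witness[c]; rewrite shE => sc.
    by exists c; split=> //; apply: placeable_leq Gi _; rewrite sc.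
  have [/existsP[c /andP[/eqP sc ic]]|/existsPn none] :=
    boolP [exists c : 'I_n, (size ((Phi n w).2 c) == 0) && (i <= c.+1)].
    by exists c; rewrite sc s0.
  have := @leq_cnt1 _ (sh (Phi n w).2) i.-1 n (leqnn _).
  move: nb; rewrite Phi_consE eF /=.
  rewrite (@cnt_add _ _ (sh (Phi n w).1) _ p) => [|c]; last by rewrite !shE sF.
  rewrite eq shE s0 /= => nb le.
  have {}nb : cnt predT (sh (Phi n w).2) 1 + 1 + i <= n.+1.
    apply: nb => b; rewrite inE => /predU1P[-> /=|bin]; first by move: i_n => /andP[].
    by have /allP/(_ b bin)/andP[/andP[]] := lw.
  have : n - i.-1 <= cnt predT (sh (Phi n w).2) 1.
    by apply: le => c /andP[ci _]; have := none c; rewrite shE; lia.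
  by move: i_n; rewrite /letter; lia.
have i0 : 0 < i by case/andP: i_n.
have [q [sq iq ql sG Gi']] := place_shape i0 Gi sc ic.
have st : rsk_step i j (sh (Phi n w).1) (sh (Phi n w).2)
    (sh (Phi n ((i, j) :: w)).1) (sh (Phi n ((i, j) :: w)).2) p q.
  rewrite Phi_consE eF /=; split=> //; try by move=> d; rewrite !shE.
  - by rewrite !shE sq.
  - move=> d di; rewrite shE; apply/eqP; rewrite -leqn0 leqNgt; apply/negP.
    by move=> /(placeable_leq Gi); lia.
  - by move=> d id dq; rewrite !shE sq; exact: ql.
  - by move=> d pd; rewrite !shE; exact: Fr.
  - by rewrite shE.
  - by move=> m fm; apply: Fm => d /fm; rewrite shE.
split; last by exists p, q.
split=> [|h|i' i'w]; first by apply: Phi_ssaf; case/andP: bw.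
  exact: (equi_step (step_f st) (step_g st) (step_pq st) eq).
have i'i : i' <= i by have := i'w (i, j) (mem_head _ _).
rewrite Phi_consE eF /= => d; have [Gs Ga] := Gi' d; split=> //.
by apply: sub_all Ga => x; exact: leq_trans.
Qed.

Lemma Phi_inv w : biword n w -> rsk_inv w (Phi n w).
Proof.
elim: w => [|[i j] w IH] bw; last first.
  by have [_ _ bw' _ _] := biword_cons bw; case: (Phi_step_inv bw (IH bw')).
split=> //=; first exact: ssaf_empty.
by move=> i _ c; rewrite /column ffunE.
Qed.

Lemma Phi_cons i j w : biword n ((i, j) :: w) ->
  exists p q, rsk_step i j (sh (Phi n w).1) (sh (Phi n w).2)
    (sh (Phi n ((i, j) :: w)).1) (sh (Phi n ((i, j) :: w)).2) p q.
Proof.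
move=> bw; have [_ _ bw' _ _] := biword_cons bw.
by case: (Phi_step_inv bw (Phi_inv bw')).
Qed.

(** * Supports of the shapes and the staircase condition *)

Lemma Phi_equi w h : biword n w ->
  cnt predT (sh (Phi n w).1) h = cnt predT (sh (Phi n w).2) h.
Proof. by case/Phi_inv. Qed.

Lemma insertion_support w m c : biword n w ->
  (forall b, b \in w -> b.2 <= m) -> m <= c -> sh (Phi n w).1 c = 0.
Proof.
elim: w c => [|[i j] w IH] c bw wm mc; first by rewrite shE ffunE.
have [_ _ bw' _ _] := biword_cons bw; have [p [q st]] := Phi_cons bw.
have {}IH (d : 'I_n) : m <= d -> sh (Phi n w).1 d = 0.
  by apply: IH => // b bin; apply: wm; rewrite inE bin orbT.
rewrite (step_f st) IH //; case: eqP => // cp; subst c.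
have jm : j <= m := wm (i, j) (mem_head _ _).
by have := leq_trans (step_base st (IH p mc)) jm; rewrite ltnNge mc.
Qed.

(** Opening a column beyond [k] would mean that the columns with letters [i] to [k] are all nonempty
    already, one more column than [nonempty_bound] allows. *)
Lemma recording_support w k c : biword n w -> k <= n ->
  (forall b, b \in w -> b.1 <= k) -> k <= c -> sh (Phi n w).2 c = 0.
Proof.
move=> + kn; elim: w c => [|[i j] w IH] c bw wk kc; first by rewrite shE ffunE.
have [/andP[i0 _] _ bw' _ _] := biword_cons bw; have [p [q st]] := Phi_cons bw.
have {}IH (d : 'I_n) : k <= d -> sh (Phi n w).2 d = 0.
  by apply: IH => // b bin; apply: wk; rewrite inE bin orbT.
rewrite (step_g st) IH //; case: eqP => // cq; subst c.
have g0 := IH q kc; have := nonempty_bound bw wk.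
rewrite (cnt_add _ _ (step_f st)) (step_pq st) g0 /= (Phi_equi _ bw').
have := @leq_cnt1 _ (sh (Phi n w).2) i.-1 k kn.
have ik : i <= k := wk (i, j) (mem_head _ _).
move=> /(_ _) le b; suff : k - i.-1 <= cnt predT (sh (Phi n w).2) 1 by lia.
apply: le => d /andP[di dk]; have := step_leftmost st (c := d).
by rewrite g0 lt0n; apply; lia.
Qed.

Lemma staircase_dominated w : biword n w ->
  (forall b, b \in w -> b.1 + b.2 <= n + 1) ->
  dominated (sh (Phi n w).1) (sh (Phi n w).2).
Proof.
elim: w => [|[i j] w IH] bw st.
  move=> [|h] t; first by rewrite (cnt0_rev (sh (Phi n [::]).1)).
  by rewrite /cnt big1 // => c _; rewrite shE ffunE.
have [i_n jn bw' lw lex] := biword_cons bw; have [p [q sp]] := Phi_cons bw.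
have small b : b \in (i, j) :: w -> b.2 <= n - i.-1.
  move=> bin; have := st b bin; move: bin i_n; rewrite inE /letter.
  by case/predU1P => [->|/lex] /=; lia.
apply: (@dominated_step _ _ _ _ _ _ _ (step_f sp) (step_g sp) (step_pq sp) _ i.-1).
- by move=> h; apply: Phi_equi.
- by have := step_iq sp; lia.
- by move=> c ci; apply: (step_g0 sp); lia.
- by move=> c /andP[ic cq]; apply: (step_leftmost sp) => //; lia.
- move=> c ic; apply: insertion_support ic => // b bin.
  by apply: small; rewrite inE bin orbT.
- rewrite ltnNge; apply/negP => /(insertion_support bw small).
  by rewrite (step_f sp) eqxx addn1.
by apply: IH => // b bin; apply: st; rewrite inE bin orbT.
Qed.

Lemma dominated_staircase w : biword n w ->
  dominated (sh (Phi n w).1) (sh (Phi n w).2) ->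
  forall b, b \in w -> b.1 + b.2 <= n + 1.
Proof.
elim: w => [|[i j] w IH] bw D b //.
have [i_n jn bw' lw lex] := biword_cons bw; have [p [q sp]] := Phi_cons bw.
have eq h := Phi_equi h bw'.
have {}IH : forall b, b \in w -> b.1 + b.2 <= n + 1.
  apply: IH => //; exact: (dominated_unstep (step_f sp) (step_g sp)
    (step_pq sp) eq (step_rightmost sp)).
rewrite inE => /predU1P[->{b} /=|]; last exact: IH.
rewrite leqNgt; apply/negP => big.
have sup (d : 'I_n) : n - i.-1 <= d -> sh (Phi n w).1 d = 0.
  apply: insertion_support => // b bin; have := IH b bin.
  by move: (lex b bin) i_n; rewrite /letter; lia.
have np := step_big sp sup; have {}np : n - i.-1 <= p.
  by apply: np; move: i_n; rewrite /letter; lia.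
(* At height 1 the left side counts every nonempty column of G, as many as F has, but the right side
   omits the column [p] just opened. *)
have := D 1 i.-1.
rewrite (@eq_cnt _ _ predT) => [|c]; last first.
  rewrite (step_g sp); have := step_iq sp; have := step_g0 sp (c := c).
  by case: (c =P q) => [->|_] /=; lia.
rewrite -(Phi_equi _ bw) !(cnt_add _ _ (step_f sp)) (sup p np) eqxx /= andbT.
rewrite [in leqRHS](@eq_cnt _ _ predT) => [|c]; last first.
  by case: (ltnP c (n - i.-1)) => // /sup ->.
by rewrite ltnNge np; lia.
Qed.

End RSK.

Theorem theorem3 (n : nat) (hn : 1 <= n) (w : seq (nat * nat))
    (hw : biword n w) (F G : filling n) (hFG : Phi n w = (F, G)) :
  ((forall b : nat * nat, b \in w -> b.1 + b.2 <= n + 1) <->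
     tableau_le (key (sh G)) (key (permute (longest n) (sh F))))
  /\
  (forall k m : nat, 1 <= k <= n -> 1 <= m <= n ->
     (forall b : nat * nat, b \in w -> letter k b.1) ->
     (forall b : nat * nat, b \in w -> letter m b.2) ->
     (forall c : 'I_n, k <= c -> sh G c = 0) /\
     (forall c : 'I_n, m <= c -> sh F c = 0)).
Proof.
have eF : F = (Phi n w).1 by rewrite hFG.
have eG : G = (Phi n w).2 by rewrite hFG.
rewrite {}eF {}eG; split.
  rewrite key_leP => [|h]; last exact: Phi_equi.
  by split; [exact: staircase_dominated|exact: dominated_staircase].
move=> k m /andP[_ kn] _ wk wm; split=> c.
  by apply: recording_support => // b /wk/andP[].
by apply: insertion_support => // b /wm/andP[].
Qed.
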